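(* Let $k\in C([0,1]\times[0,1],\mathbb{R})$, let $M,N$ be real constants with $0<M\le c_0$ and $N\neq 0$, and let $G=G_M$ be the Green function of $y^{(4)}+My$ on $[0,1]$ with Navier boundary conditions $y(0)=y(1)=y''(0)=y''(1)=0$. Assume that $$\|k\|_\infty:=\max\{|k(x,t)| : (x,t)\in[0,1]\times[0,1]\}<\frac{1}{|N|\,\max_{x\in[0,1]}\int_0^1 G(x,s)\,ds}.$$ Then for every $p\in C[0,1]$ and all real constants $A,B,C,D$, the nonlocal inhomogeneous boundary value problem $$y^{(4)}(x)+My(x)-N\int_0^1 k(x,t)y(t)\,dt=p(x),\quad x\in(0,1),$$ $$y(0)=A,\quad y(1)=B,\quad y''(0)=C,\quad y''(1)=D$$ has a unique solution $y\in C^4[0,1]$.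
   Context: Functions are real-valued. For $M>0$, $G=G_M:[0,1]\times[0,1]\to\mathbb{R}$ is the unique continuous function such that for every $q\in C[0,1]$ the function $y(x)=\int_0^1G(x,s)q(s)\,ds$ is the unique $C^4[0,1]$ solution of $y^{(4)}(x)+My(x)=q(x)$ on $(0,1)$, $y(0)=y(1)=y''(0)=y''(1)=0$. The constant $c_0\approx 950.8843$ is $c_0=4k_0^4$, where $k_0\approx 3.9266$ is the smallest positive solution of $\tan k=\tanh k$. It is known (Cabada, Cid, Sanchez, 2007) that $G_M\ge 0$ on $[0,1]\times[0,1]$ whenever $0<M\le c_0$. *)

(* Defs.v *)
From Stdlib Require Export Reals.
From Coquelicot Require Export Coquelicot.

Open Scope R_scope.

Definition I01 (x : R) : Prop := 0 <= x <= 1.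

Definition square01 (z : R * R) : Prop := I01 (fst z) /\ I01 (snd z).

(* A function on [0,1] is represented by a total function R -> R of which only
   the values on [0,1] matter; continuity and derivatives are therefore taken
   within [0,1], hence one-sided at the end points. *)
Definition continuous01 (f : R -> R) : Prop := continuous_on I01 f.

Definition continuous_square01 (k : R -> R -> R) : Prop :=
  continuous_on square01 (fun z : R * R => k (fst z) (snd z)).

Definition derivative01 (f df : R -> R) : Prop :=
  forall x, I01 x -> D_in f df I01 x.

(* y is of class C^4 on [0,1] and y1, ..., y4 are its successive derivatives;
   these are uniquely determined by y on [0,1]. *)
Definition C4_derivatives (y y1 y2 y3 y4 : R -> R) : Prop :=
  derivative01 y y1 /\ derivative01 y1 y2 /\ derivative01 y2 y3 /\
  derivative01 y3 y4 /\ continuous01 y4.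

Definition equal01 (f g : R -> R) : Prop := forall x, I01 x -> f x = g x.

Definition unique_solution01 (P : (R -> R) -> Prop) (y : R -> R) : Prop :=
  P y /\ forall z, P z -> equal01 z y.

Definition homogeneous_solution (M : R) (q y : R -> R) : Prop :=
  exists y1 y2 y3 y4 : R -> R,
    C4_derivatives y y1 y2 y3 y4 /\
    (forall x, 0 < x < 1 -> y4 x + M * y x = q x) /\
    y 0 = 0 /\ y 1 = 0 /\ y2 0 = 0 /\ y2 1 = 0.

Definition is_green (M : R) (G : R -> R -> R) : Prop :=
  continuous_square01 G /\
  forall q : R -> R, continuous01 q ->
    unique_solution01 (homogeneous_solution M q)
      (fun x => RInt (fun s => G x s * q s) 0 1).

Definition nonlocal_solution (M N : R) (k : R -> R -> R) (p : R -> R)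
    (A B C D : R) (y : R -> R) : Prop :=
  exists y1 y2 y3 y4 : R -> R,
    C4_derivatives y y1 y2 y3 y4 /\
    (forall x, 0 < x < 1 ->
       y4 x + M * y x - N * RInt (fun t => k x t * y t) 0 1 = p x) /\
    y 0 = A /\ y 1 = B /\ y2 0 = C /\ y2 1 = D.

Definition is_max_on {T : Type} (D : T -> Prop) (f : T -> R) (m : R) : Prop :=
  (exists z, D z /\ f z = m) /\ forall z, D z -> f z <= m.

(* tan is a total function with an arbitrary value where cos vanishes, so the
   poles have to be excluded explicitly. *)
Definition positive_root_tan_tanh (k : R) : Prop :=
  0 < k /\ cos k <> 0 /\ tan k = tanh k.

Definition is_c0 (c : R) : Prop :=
  exists k0 : R,
    positive_root_tan_tanh k0 /\
    (forall k, positive_root_tan_tanh k -> k0 <= k) /\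
    c = 4 * k0 ^ 4.

(* Main.v *)
Require Import Defs.
From Stdlib Require Import Reals Lra Lia.
From Coquelicot Require Import Coquelicot.

(** The heart of the matter is that the Navier problem for y'''' + M y, with
    0 < M <= c0, preserves positivity: a nonnegative right-hand side gives a
    nonnegative solution ([navier_maximum_principle]).  Granting this, let e be
    the solution with right-hand side 1, that is the integral of G x over
    [0,1].  Comparing with c e shows that a right-hand side bounded by c gives
    a solution bounded by c maxG ([comparison_bound]).  After subtraction of a
    cubic with the prescribed boundary data, the nonlocal problem becomes the
    fixed point equation u = P + T (p - M P + N K u), where T is the Green
    operator and K the integral operator of kernel k.  Its right-hand side
    contracts the sup norm with ratio |N| normk maxG < 1.  Banach's theorem
    ([contraction_fixed_point]) gives a solution, and applying the contraction
    estimate to the difference of two solutions, at a point where its absolute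
    value is maximal, gives uniqueness.

    Positivity is proved without integrating against G.  Write M = 4 m^4.  Up
    to a positive factor, G x s = J (m (1 - |x - s|)) - J (m (1 - x - s)),
    where J is an even combination of cosh cos and sinh sin with J' m = 0; this
    is the method of images for the fundamental solution of period 2.  Thus G
    is nonnegative as soon as J increases on [0, m].  Now J' t is the value of
    tan / tanh at m minus its value at t, times cos t cos m and a positive
    factor.  Since tan / tanh increases on each branch of tan, J' is
    nonnegative on [0, m] as long as m does not exceed the first positive root
    of tan = tanh ([beam1_nonneg]), which is the meaning of M <= c0.  Green's
    identity between G x and a solution y is then replaced by the monotonicity
    of their concomitant on [0, x] and on [x, 1], whose jump at s = x recovers
    y x. *)

(** * Sign of the kernel's derivative below the first root of tan = tanh *)

Lemma sinh_pos (x : R) : 0 < x -> 0 < sinh x.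
Proof. intros Hx. rewrite <- sinh_0. now apply sinh_lt. Qed.

Lemma cosh_pos (x : R) : 0 < cosh x.
Proof.
unfold cosh.
pose proof (exp_pos x). pose proof (exp_pos (- x)). lra.
Qed.

Lemma sinh_neg (x : R) : sinh (- x) = - sinh x.
Proof. unfold sinh. rewrite Ropp_involutive. lra. Qed.

Lemma cosh_neg (x : R) : cosh (- x) = cosh x.
Proof. unfold cosh. rewrite Ropp_involutive. lra. Qed.

Lemma mono_of_derive_nonneg (f df : R -> R) (a b : R) :
  a <= b ->
  (forall x, a <= x <= b -> continuous f x) ->
  (forall x, a < x < b -> is_derive f x (df x)) ->
  (forall x, a < x < b -> 0 <= df x) ->
  f a <= f b.
Proof.
intros Hab Hc Hd Hp.
(* The intermediate point given by the mean value theorem may be an end point,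
   where the sign of [df] is unknown; [Rmax 0 (df x)] is nonnegative there too. *)
destruct (MVT_gen f a b (fun x => Rmax 0 (df x))) as [c [_ Ec]].
- rewrite Rmin_left, Rmax_right by lra. intros x Hx.
  rewrite Rmax_right by auto. auto.
- rewrite Rmin_left, Rmax_right by lra. intros x Hx.
  apply continuity_pt_filterlim. now apply Hc.
- pose proof (Rmax_l 0 (df c)). nra.
Qed.

Lemma is_derive_imp_continuous (f : R -> R) (x l : R) :
  is_derive f x l -> continuous f x.
Proof. intros H. apply (ex_derive_continuous f). now exists l. Qed.

(** Away from the zeros of cos it vanishes exactly where tan = tanh; unlike
    tan - tanh it is smooth across the poles of tan. *)
Definition tan_tanh_gap (z : R) : R := sin z * cosh z - cos z * sinh z.

Lemma is_derive_tan_tanh_gap (z : R) :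
  is_derive tan_tanh_gap z (2 * (sin z * sinh z)).
Proof. unfold tan_tanh_gap. auto_derive; [easy | ring]. Qed.

Lemma tan_tanh_gap_nonneg_le_PI (z : R) : 0 <= z <= PI -> 0 <= tan_tanh_gap z.
Proof.
intros [H0 H1].
replace 0 with (tan_tanh_gap 0).
2: { unfold tan_tanh_gap. rewrite sin_0, sinh_0. ring. }
apply mono_of_derive_nonneg with (df := fun z => 2 * (sin z * sinh z)).
- easy.
- intros x _. eapply is_derive_imp_continuous, is_derive_tan_tanh_gap.
- intros x _. apply is_derive_tan_tanh_gap.
- intros x Hx.
  assert (0 < sin x) by (apply sin_gt_0; lra).
  assert (0 < sinh x) by (apply sinh_pos; lra). nra.
Qed.

Lemma positive_root_of_gap (z : R) :
  0 < z -> cos z <> 0 -> tan_tanh_gap z = 0 -> positive_root_tan_tanh z.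
Proof.
intros Hz Hc E. split; [easy | split; [easy |]].
pose proof (cosh_pos z).
unfold tan, tanh. unfold tan_tanh_gap in E.
apply Rmult_eq_reg_r with (cos z * cosh z).
- field_simplify; lra.
- apply Rmult_integral_contrapositive; lra.
Qed.

Lemma gap_root_between (b : R) :
  PI <= b <= 3 * (PI / 2) -> tan_tanh_gap b < 0 ->
  exists z, positive_root_tan_tanh z /\ z < b.
Proof.
intros Hb Hgap. pose proof PI_RGT_0.
destruct (IVT_cor tan_tanh_gap PI b) as [z [Hz Ez]].
- intros x. apply continuity_pt_filterlim.
  eapply is_derive_imp_continuous, is_derive_tan_tanh_gap.
- easy.
- assert (0 <= tan_tanh_gap PI) by (apply tan_tanh_gap_nonneg_le_PI; lra). nra.
- assert (Hzb : z < b).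
  { destruct (Req_dec z b) as [-> |]; lra. }
  exists z. split; [| easy].
  apply positive_root_of_gap; [lra | | easy].
  assert (cos z < 0) by (apply cos_lt_0; lra). lra.
Qed.

(** Between pi and 3 pi / 2 the gap goes from positive to negative, hence
    vanishes at a root of tan = tanh; so an m not exceeding the first root lies
    below 3 pi / 2 and the gap has not yet changed sign there. *)
Lemma gap_nonneg_below_first_root (k0 m : R) :
  (forall k, positive_root_tan_tanh k -> k0 <= k) ->
  0 < m <= k0 -> m < 3 * (PI / 2) /\ 0 <= tan_tanh_gap m.
Proof.
intros Hmin Hm. pose proof PI_RGT_0.
assert (Hm32 : m < 3 * (PI / 2)).
{ destruct (gap_root_between (3 * (PI / 2))) as [z [Hz1 Hz2]].
  - lra.
  - unfold tan_tanh_gap. rewrite sin_3PI2, cos_3PI2.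
    pose proof (cosh_pos (3 * (PI / 2))). lra.
  - apply Hmin in Hz1. lra. }
split; [easy |].
destruct (Rle_dec m PI); [apply tan_tanh_gap_nonneg_le_PI; lra |].
destruct (Rle_dec 0 (tan_tanh_gap m)) as [| Hn]; [easy |].
destruct (gap_root_between m) as [z [Hz1 Hz2]]; [lra | lra |].
apply Hmin in Hz1. lra.
Qed.

Lemma sin_cos_le_sinh_cosh (x : R) : 0 <= x -> sin x * cos x <= cosh x * sinh x.
Proof.
intros Hx.
apply Rminus_le_0.
replace 0 with (cosh 0 * sinh 0 - sin 0 * cos 0)
  by (rewrite sin_0, sinh_0; ring).
apply mono_of_derive_nonneg with
  (f := fun x => cosh x * sinh x - sin x * cos x)
  (df := fun x => 2 * sinh x * sinh x + 2 * sin x * sin x).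
- easy.
- intros y _. apply (ex_derive_continuous (V := R_NormedModule)). now auto_derive.
- intros y _. auto_derive; [easy |].
  assert (E1 : cosh y * cosh y - sinh y * sinh y = 1).
  { unfold cosh, sinh. rewrite exp_Ropp. field. apply Rgt_not_eq, exp_pos. }
  pose proof (sin2_cos2 y) as E2. unfold Rsqr in E2. lra.
- intros y _. nra.
Qed.

(** The derivative of tan / tanh has the sign of cosh sinh - sin cos, that is
    of sinh (2 x) - sin (2 x). *)
Lemma tan_over_tanh_increasing (t m : R) :
  0 < t <= m -> (forall x, t <= x <= m -> cos x <> 0) ->
  sin t * cosh t / (cos t * sinh t) <= sin m * cosh m / (cos m * sinh m).
Proof.
intros Ht Hcos.
assert (Hd : forall x, t <= x <= m -> cos x * sinh x <> 0).
{ intros x Hx. apply Rmult_integral_contrapositive. split; [auto |].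
  apply Rgt_not_eq, sinh_pos. lra. }
assert (D : forall x, t <= x <= m ->
  is_derive (fun x => sin x * cosh x / (cos x * sinh x)) x
    ((cosh x * sinh x - sin x * cos x) / (cos x * sinh x) ^ 2)).
{ intros x Hx. specialize (Hd x Hx). auto_derive; [easy |].
  assert (E1 : cosh x * cosh x = 1 + sinh x * sinh x).
  { unfold cosh, sinh. rewrite exp_Ropp. field. apply Rgt_not_eq, exp_pos. }
  pose proof (sin2_cos2 x) as E2. unfold Rsqr in E2.
  assert (cos x <> 0) by (intros E; rewrite E in Hd; lra).
  assert (sinh x <> 0) by (intros E; rewrite E in Hd; lra).
  apply Rmult_eq_reg_r with ((cos x * sinh x) ^ 2); [| now apply pow_nonzero].
  field_simplify; [| easy | easy].
  replace (cosh x ^ 2) with (1 + sinh x * sinh x) by (simpl; lra).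
  replace (sin x ^ 2) with (1 - cos x * cos x) by (simpl; lra).
  ring. }
apply mono_of_derive_nonneg with (f := fun x => sin x * cosh x / (cos x * sinh x))
  (df := fun x => (cosh x * sinh x - sin x * cos x) / (cos x * sinh x) ^ 2).
- lra.
- intros x Hx. eapply is_derive_imp_continuous, D, Hx.
- intros x Hx. apply D. lra.
- intros x Hx.
  apply Rdiv_le_0_compat.
  + pose proof (sin_cos_le_sinh_cosh x). lra.
  + rewrite <- Rsqr_pow2. apply Rlt_0_sqr, Hd. lra.
Qed.

(** Coefficients chosen so that the derivative [beam1 m] vanishes at m. *)
Definition beam_alpha (m : R) : R := cosh m * sin m.
Definition beam_beta (m : R) : R := - (sinh m * cos m).

Definition beam1 (m t : R) : R :=
  beam_alpha m * (sinh t * cos t) + beam_beta m * (cosh t * sin t).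

Lemma beam1_nonneg_same_branch (t m : R) :
  0 < t <= m ->
  (forall x, t <= x <= m -> cos x <> 0) -> 0 < cos t * cos m -> 0 <= beam1 m t.
Proof.
intros Ht Hc Hs.
pose proof (tan_over_tanh_increasing t m Ht Hc) as Hr.
assert (S1 : 0 < sinh t) by (apply sinh_pos; lra).
assert (S2 : 0 < sinh m) by (apply sinh_pos; lra).
assert (C1 : cos t <> 0) by (apply Hc; lra).
assert (C2 : cos m <> 0) by (apply Hc; lra).
replace (beam1 m t) with
  ((cos t * cos m) * (sinh t * sinh m) *
   (sin m * cosh m / (cos m * sinh m) - sin t * cosh t / (cos t * sinh t)))
  by (unfold beam1, beam_alpha, beam_beta; field; lra).
apply Rmult_le_pos; [| lra].
apply Rmult_le_pos; nra.
Qed.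

(** Writing r for tan / tanh, [beam1 m t] has the sign of
    (r m - r t) cos t cos m.  When t and m lie on the same branch of tan this
    is nonnegative because r increases there.  Across the pole at pi / 2 the
    signs of the trigonometric factors suffice up to m = pi, and beyond pi one
    uses r m <= 1 <= r t, which is where the bound by the first root of
    tan = tanh enters. *)
Lemma beam1_nonneg (m t : R) :
  m < 3 * (PI / 2) -> 0 <= tan_tanh_gap m -> 0 <= t <= m -> 0 <= beam1 m t.
Proof.
intros Hm Hgap Ht. pose proof PI_RGT_0.
destruct (Req_dec t 0) as [-> | Ht0].
{ unfold beam1. rewrite sinh_0, sin_0. lra. }
assert (S1 : 0 < sinh t) by (apply sinh_pos; lra).
assert (S2 : 0 < sinh m) by (apply sinh_pos; lra).
pose proof (cosh_pos t) as C1. pose proof (cosh_pos m) as C2.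
destruct (Rlt_le_dec (PI / 2) t) as [Htp | Htp].
- assert (Hneg : forall x, t <= x <= m -> cos x < 0)
    by (intros x Hx; apply cos_lt_0; lra).
  apply beam1_nonneg_same_branch; [lra | |].
  + intros x Hx. specialize (Hneg x Hx). lra.
  + pose proof (Hneg t ltac:(lra)). pose proof (Hneg m ltac:(lra)). nra.
- destruct (Rlt_le_dec m (PI / 2)) as [Hmp | Hmp].
  + assert (Hpos : forall x, t <= x <= m -> 0 < cos x)
      by (intros x Hx; apply cos_gt_0; lra).
    apply beam1_nonneg_same_branch; [lra | |].
    * intros x Hx. specialize (Hpos x Hx). lra.
    * pose proof (Hpos t ltac:(lra)). pose proof (Hpos m ltac:(lra)). nra.
  + assert (Ts : 0 <= sin t) by (apply sin_ge_0; lra).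
    assert (Tc : 0 <= cos t) by (apply cos_ge_0; lra).
    assert (Mc : cos m <= 0) by (apply cos_le_0; lra).
    assert (P1 : 0 <= - cos m * sinh m) by nra.
    unfold beam1, beam_alpha, beam_beta.
    destruct (Rle_dec m PI) as [Hmpi | Hmpi].
    * assert (Ms : 0 <= sin m) by (apply sin_ge_0; lra).
      assert (0 <= (cosh m * sin m) * (sinh t * cos t)) by
        (apply Rmult_le_pos; apply Rmult_le_pos; lra).
      assert (0 <= (- cos m * sinh m) * (cosh t * sin t)) by
        (apply Rmult_le_pos; [lra | apply Rmult_le_pos; lra]).
      lra.
    * assert (Tgap : 0 <= tan_tanh_gap t)
        by (apply tan_tanh_gap_nonneg_le_PI; lra).
      assert (0 <= (- cos m * sinh m) * tan_tanh_gap t)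
        by (apply Rmult_le_pos; lra).
      assert (0 <= tan_tanh_gap m * (sinh t * cos t))
        by (apply Rmult_le_pos; [lra | nra]).
      unfold tan_tanh_gap in *. lra.
Qed.

(** An even solution J of J'''' = -4 J with J' m = 0; its next derivatives
    are [beam1], [beam2], [beam3]. *)
Definition beam0 (m t : R) : R :=
  (beam_alpha m - beam_beta m) / 2 * (cosh t * cos t) +
  (beam_alpha m + beam_beta m) / 2 * (sinh t * sin t).
Definition beam2 (m t : R) : R :=
  (beam_alpha m + beam_beta m) * (cosh t * cos t) +
  (beam_beta m - beam_alpha m) * (sinh t * sin t).
Definition beam3 (m t : R) : R :=
  2 * beam_beta m * (sinh t * cos t) - 2 * beam_alpha m * (cosh t * sin t).

Lemma is_derive_beam0 (m t : R) : is_derive (beam0 m) t (beam1 m t).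
Proof. unfold beam0, beam1. auto_derive; [easy | field]. Qed.
Lemma is_derive_beam1 (m t : R) : is_derive (beam1 m) t (beam2 m t).
Proof. unfold beam1, beam2. auto_derive; [easy | ring]. Qed.
Lemma is_derive_beam2 (m t : R) : is_derive (beam2 m) t (beam3 m t).
Proof. unfold beam2, beam3. auto_derive; [easy | ring]. Qed.
Lemma is_derive_beam3 (m t : R) : is_derive (beam3 m) t (-4 * beam0 m t).
Proof. unfold beam3, beam0. auto_derive; [easy | field]. Qed.

Lemma beam0_even (m t : R) : beam0 m (- t) = beam0 m t.
Proof. unfold beam0. rewrite cosh_neg, sinh_neg, cos_neg, sin_neg. ring. Qed.
Lemma beam2_even (m t : R) : beam2 m (- t) = beam2 m t.
Proof. unfold beam2. rewrite cosh_neg, sinh_neg, cos_neg, sin_neg. ring. Qed.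

Lemma beam1_end (m : R) : beam1 m m = 0.
Proof. unfold beam1, beam_alpha, beam_beta. ring. Qed.

Lemma beam3_end_neg (m : R) : 0 < m -> beam3 m m < 0.
Proof.
intros Hm.
pose proof (sinh_pos m Hm) as S. pose proof (cosh_pos m) as C.
pose proof (sin2_cos2 m) as E. unfold Rsqr in E.
replace (beam3 m m) with (- 2 * ((sinh m * cos m) ^ 2 + (cosh m * sin m) ^ 2))
  by (unfold beam3, beam_alpha, beam_beta; ring).
destruct (Req_dec (sin m) 0) as [Z | Z].
- assert (cos m <> 0) by (intros Z'; rewrite Z, Z' in E; lra).
  assert (0 < (sinh m * cos m) ^ 2)
    by (rewrite <- Rsqr_pow2; apply Rlt_0_sqr, Rmult_integral_contrapositive; lra).
  pose proof (pow2_ge_0 (cosh m * sin m)). lra.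
- assert (0 < (cosh m * sin m) ^ 2)
    by (rewrite <- Rsqr_pow2; apply Rlt_0_sqr, Rmult_integral_contrapositive; lra).
  pose proof (pow2_ge_0 (sinh m * cos m)). lra.
Qed.

Lemma beam0_increasing (m : R) :
  (forall t, 0 <= t <= m -> 0 <= beam1 m t) ->
  forall u v, Rabs u <= v <= m -> beam0 m u <= beam0 m v.
Proof.
intros H u v Huv.
assert (E : beam0 m u = beam0 m (Rabs u)).
{ unfold Rabs. destruct (Rcase_abs u); [symmetry; apply beam0_even | easy]. }
rewrite E. pose proof (Rabs_pos u).
apply mono_of_derive_nonneg with (df := beam1 m).
- lra.
- intros x _. eapply is_derive_imp_continuous, is_derive_beam0.
- intros x _. apply is_derive_beam0.
- intros x Hx. apply H. lra.
Qed.

(** * Continuity and derivatives within the unit interval *)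

(** Composing with this retraction turns a function continuous on [0,1] into
    one continuous on R, to which the theorems about total functions apply. *)
Definition clamp (x : R) : R := Rmax 0 (Rmin 1 x).

Lemma clamp_I01 (x : R) : I01 (clamp x).
Proof.
unfold clamp, I01. split; [apply Rmax_l |].
apply Rmax_lub; [lra | apply Rmin_l].
Qed.

Lemma clamp_id (x : R) : I01 x -> clamp x = x.
Proof.
intros [H0 H1]. unfold clamp. rewrite Rmin_right, Rmax_right; lra.
Qed.

Lemma clamp_lipschitz (x y : R) : Rabs (clamp x - clamp y) <= Rabs (x - y).
Proof.
unfold clamp, Rmax, Rmin.
repeat destruct Rle_dec; unfold Rabs; repeat destruct Rcase_abs; lra.
Qed.

Lemma continuous01_eps (f : R -> R) :
  continuous01 f <->
  forall x, I01 x -> forall eps : posreal, exists delta : posreal,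
    forall y, I01 y -> Rabs (y - x) < delta -> Rabs (f y - f x) < eps.
Proof.
split.
- intros H x Hx eps.
  destruct (proj1 (filterlim_locally _ _) (H x Hx) eps) as [d Hd].
  exists d. intros y Hy Hyx. now apply Hd.
- intros H x Hx. apply filterlim_locally. intros eps.
  destruct (H x Hx eps) as [d Hd].
  exists d. intros y Hyx Hy. now apply Hd.
Qed.

Lemma continuous01_clamp (f : R -> R) :
  continuous01 f <-> forall x, continuous (fun x => f (clamp x)) x.
Proof.
split.
- intros H x. apply filterlim_locally. intros eps.
  destruct (proj1 (continuous01_eps f) H (clamp x) (clamp_I01 x) eps) as [d Hd].
  exists d. intros y Hy. apply Hd; [apply clamp_I01 |].
  eapply Rle_lt_trans; [apply clamp_lipschitz | exact Hy].
- intros H. apply continuous01_eps. intros x Hx eps.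
  destruct (proj1 (filterlim_locally _ _) (H x) eps) as [d Hd].
  exists d. intros y Hy Hyx. specialize (Hd y Hyx).
  rewrite !clamp_id in Hd by easy. exact Hd.
Qed.

Lemma continuous01_ext (f g : R -> R) :
  equal01 f g -> continuous01 f -> continuous01 g.
Proof.
intros E H. apply continuous01_eps. intros x Hx eps.
destruct (proj1 (continuous01_eps f) H x Hx eps) as [d Hd].
exists d. intros y Hy Hyx. rewrite <- !E by easy. auto.
Qed.

Lemma continuous01_of_continuous (f : R -> R) :
  (forall x, continuous f x) -> continuous01 f.
Proof.
intros H x _. eapply filterlim_filter_le_1; [| apply H]. apply filter_le_within.
Qed.

Lemma continuous01_const (c : R) : continuous01 (fun _ => c).
Proof. apply continuous01_of_continuous. intros x. apply continuous_const. Qed.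

Lemma continuous01_plus (f g : R -> R) :
  continuous01 f -> continuous01 g -> continuous01 (fun x => f x + g x).
Proof.
rewrite !continuous01_clamp. intros Hf Hg x.
exact (continuous_plus _ _ x (Hf x) (Hg x)).
Qed.

Lemma continuous01_mult (f g : R -> R) :
  continuous01 f -> continuous01 g -> continuous01 (fun x => f x * g x).
Proof.
rewrite !continuous01_clamp. intros Hf Hg x.
exact (continuous_mult (fun x => f (clamp x)) (fun x => g (clamp x)) x (Hf x) (Hg x)).
Qed.

Lemma continuous01_lin (a b : R) (f g : R -> R) :
  continuous01 f -> continuous01 g -> continuous01 (fun x => a * f x + b * g x).
Proof.
intros Hf Hg.
apply continuous01_plus; apply continuous01_mult; auto using continuous01_const.
Qed.

Lemma ex_RInt_continuous01 (f : R -> R) : continuous01 f -> ex_RInt f 0 1.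
Proof.
intros H. apply ex_RInt_ext with (fun x => f (clamp x)).
- rewrite Rmin_left, Rmax_right by lra. intros x Hx.
  rewrite clamp_id; [easy | split; lra].
- apply (ex_RInt_continuous (V := R_CompleteNormedModule)).
  intros x _. now apply continuous01_clamp.
Qed.

Lemma abs_max01 (f : R -> R) :
  continuous01 f ->
  exists x0, I01 x0 /\ forall x, I01 x -> Rabs (f x) <= Rabs (f x0).
Proof.
intros H.
destruct (continuity_ab_maj (fun x => Rabs (f (clamp x))) 0 1) as [x0 [Hm Hx0]].
- lra.
- intros c _. apply continuity_pt_filterlim.
  apply (continuous_comp (fun x => f (clamp x)) Rabs).
  + now apply continuous01_clamp.
  + apply continuous_Rabs.
- exists x0. split; [easy |]. intros x Hx. specialize (Hm x Hx).
  now rewrite !clamp_id in Hm by easy.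
Qed.

Lemma derivative01_continuous01 (f df : R -> R) :
  derivative01 f df -> continuous01 f.
Proof.
intros H. apply continuous01_eps. intros x Hx eps.
destruct (cont_deriv _ _ _ _ (H x Hx) eps (cond_pos eps)) as [d [Hd1 Hd2]].
exists (mkposreal d Hd1). intros y Hy Hyx.
destruct (Req_dec y x) as [-> | Hne].
- rewrite Rminus_diag, Rabs_R0. apply cond_pos.
- apply Hd2. repeat split; [apply Hy | apply Hy | lra | exact Hyx].
Qed.

Lemma derivative01_interior (f df : R -> R) (x : R) :
  derivative01 f df -> 0 < x < 1 -> is_derive f x (df x).
Proof.
intros H Hx. apply is_derive_Reals. intros eps Heps.
destruct (H x (conj (Rlt_le _ _ (proj1 Hx)) (Rlt_le _ _ (proj2 Hx))) eps Heps)
  as [d [Hd1 Hd2]].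
assert (Hr : 0 < Rmin d (Rmin x (1 - x))) by (repeat apply Rmin_pos; lra).
exists (mkposreal _ Hr). simpl. intros h Hh0 Hh.
assert (B1 := Rmin_l d (Rmin x (1 - x))).
assert (B2 := Rmin_r d (Rmin x (1 - x))).
assert (B3 := Rmin_l x (1 - x)). assert (B4 := Rmin_r x (1 - x)).
assert (Habs := Rabs_def2 h _ Hh).
specialize (Hd2 (x + h)). simpl in Hd2. unfold Rdist in Hd2.
replace (x + h - x) with h in Hd2 by ring.
apply Hd2. repeat split; lra.
Qed.

Lemma derivative01_of_is_derive (f df : R -> R) :
  (forall x, is_derive f x (df x)) -> derivative01 f df.
Proof.
intros H x Hx eps Heps.
assert (D : derivable_pt_lim f x (df x)) by now apply is_derive_Reals.
apply derivable_pt_lim_D_in in D.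
destruct (D eps Heps) as [d [Hd1 Hd2]].
exists d. split; [easy |]. intros y [[_ Hy1] Hy2]. apply Hd2. now repeat split.
Qed.

Lemma derivative01_lin (a b : R) (f df g dg : R -> R) :
  derivative01 f df -> derivative01 g dg ->
  derivative01 (fun x => a * f x + b * g x) (fun x => a * df x + b * dg x).
Proof.
intros Hf Hg x Hx.
apply (Dadd I01 (fun x => a * df x) (fun x => b * dg x)
  (fun x => a * f x) (fun x => b * g x)); apply Dmult_const; auto.
Qed.

Lemma C4_derivatives_lin (a b : R) (y y1 y2 y3 y4 z z1 z2 z3 z4 : R -> R) :
  C4_derivatives y y1 y2 y3 y4 -> C4_derivatives z z1 z2 z3 z4 ->
  C4_derivatives (fun x => a * y x + b * z x) (fun x => a * y1 x + b * z1 x)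
    (fun x => a * y2 x + b * z2 x) (fun x => a * y3 x + b * z3 x)
    (fun x => a * y4 x + b * z4 x).
Proof.
intros (Y1 & Y2 & Y3 & Y4 & Yc) (Z1 & Z2 & Z3 & Z4 & Zc).
repeat split; auto using derivative01_lin, continuous01_lin.
Qed.

(** * Maximum principle for the Navier problem *)

(** For h'''' = - M h and y'''' + M y = q, this expression has derivative
    h q. *)
Definition concomitant (h h1 h2 h3 y y1 y2 y3 : R -> R) (s : R) : R :=
  h s * y3 s - h1 s * y2 s + h2 s * y1 s - h3 s * y s.

Lemma concomitant_increasing (M a b : R) (h h1 h2 h3 y y1 y2 y3 y4 : R -> R) :
  0 <= a -> a <= b -> b <= 1 ->
  C4_derivatives y y1 y2 y3 y4 ->
  (forall s, is_derive h s (h1 s)) -> (forall s, is_derive h1 s (h2 s)) ->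
  (forall s, is_derive h2 s (h3 s)) -> (forall s, is_derive h3 s (- M * h s)) ->
  (forall s, a < s < b -> 0 <= h s) ->
  (forall s, 0 < s < 1 -> 0 <= y4 s + M * y s) ->
  concomitant h h1 h2 h3 y y1 y2 y3 a <= concomitant h h1 h2 h3 y y1 y2 y3 b.
Proof.
intros Ha Hab Hb (Y1 & Y2 & Y3 & Y4 & _) H1 H2 H3 H4 Hpos Hq.
set (F := concomitant h h1 h2 h3 y y1 y2 y3).
assert (Fc : continuous01 F).
{ assert (hc : forall g dg : R -> R,
    (forall s, is_derive g s (dg s)) -> continuous01 g).
  { intros g dg Hg. apply continuous01_of_continuous. intros s.
    eapply is_derive_imp_continuous, Hg. }
  apply continuous01_ext with
    (fun s => 1 * (1 * (h s * y3 s) + -1 * (h1 s * y2 s))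
            + 1 * (1 * (h2 s * y1 s) + -1 * (h3 s * y s))).
  { intros s _. unfold F, concomitant. ring. }
  repeat apply continuous01_lin; apply continuous01_mult;
    solve [eapply hc; eassumption | exact (hc _ _ H4)
      | eapply derivative01_continuous01; eassumption]. }
rewrite <- (clamp_id a), <- (clamp_id b) by (split; lra).
apply mono_of_derive_nonneg with (f := fun s => F (clamp s))
  (df := fun s => h s * (y4 s + M * y s)).
- easy.
- intros s _. now apply continuous01_clamp.
- intros s Hs. assert (Hs1 : 0 < s < 1) by lra.
  apply is_derive_ext_loc with F.
  { assert (Hr : 0 < Rmin s (1 - s)) by (apply Rmin_pos; lra).
    exists (mkposreal _ Hr). intros u Hu.
    assert (Hu' := Rabs_def2 _ _ Hu). simpl in Hu'.
    unfold minus, plus, opp in Hu'; simpl in Hu'.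
    pose proof (Rmin_l s (1 - s)). pose proof (Rmin_r s (1 - s)).
    rewrite clamp_id; [easy | split; lra]. }
  pose proof (derivative01_interior _ _ s Y1 Hs1) as D1.
  pose proof (derivative01_interior _ _ s Y2 Hs1) as D2.
  pose proof (derivative01_interior _ _ s Y3 Hs1) as D3.
  pose proof (derivative01_interior _ _ s Y4 Hs1) as D4.
  specialize (H1 s). specialize (H2 s). specialize (H3 s). specialize (H4 s).
  unfold F, concomitant. auto_derive.
  + repeat split; eexists; eassumption.
  + assert (U : forall (g : R -> R) (l : R),
      is_derive g s l -> Derive (fun x : R => g x) s = l)
      by exact (fun g l => is_derive_unique g s l).
    rewrite (U _ _ D1), (U _ _ D2), (U _ _ D3), (U _ _ D4),
      (U _ _ H1), (U _ _ H2), (U _ _ H3), (U _ _ H4).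
    ring.
- intros s Hs. apply Rmult_le_pos; [apply Hpos | apply Hq]; lra.
Qed.

Lemma is_derive_affine (f : R -> R) (a c s l : R) :
  is_derive f (a * s + c) l -> is_derive (fun s => f (a * s + c)) s (a * l).
Proof.
intros H.
apply (is_derive_comp f (fun s => a * s + c) s l a H).
auto_derive; [easy | ring].
Qed.

(** The n-th derivative in s of f (a s + c) - f (b s + d), when g is the n-th
    derivative of f. *)
Definition affine_diff (n : nat) (a b c d : R) (g : R -> R) (s : R) : R :=
  a ^ n * g (a * s + c) - b ^ n * g (b * s + d).

Lemma is_derive_affine_diff (n : nat) (a b c d : R) (g dg : R -> R) (s : R) :
  (forall t, is_derive g t (dg t)) ->
  is_derive (affine_diff n a b c d g) s (affine_diff (S n) a b c d dg s).
Proof.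
intros H. unfold affine_diff.
replace (a ^ S n * dg (a * s + c) - b ^ S n * dg (b * s + d)) with
  (a ^ n * (a * dg (a * s + c)) - b ^ n * (b * dg (b * s + d)))
  by (simpl; ring).
apply (is_derive_minus (V := R_NormedModule)
  (fun s => a ^ n * g (a * s + c)) (fun s => b ^ n * g (b * s + d)));
  apply is_derive_scal; apply is_derive_affine; apply H.
Qed.

(** Both halves of the Green function, s <= x and s >= x, are of the form
    J (a s + c) - J (b s + d) with slopes a and b equal to m or - m, so one
    statement serves for both. *)
Lemma beam_concomitant_increasing (m lo hi a b c d : R) (y y1 y2 y3 y4 : R -> R) :
  a ^ 2 = m ^ 2 -> b ^ 2 = m ^ 2 ->
  0 <= lo -> lo <= hi -> hi <= 1 ->
  (forall t, 0 <= t <= m -> 0 <= beam1 m t) ->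
  (forall s, lo < s < hi -> Rabs (b * s + d) <= a * s + c <= m) ->
  C4_derivatives y y1 y2 y3 y4 ->
  (forall s, 0 < s < 1 -> 0 <= y4 s + 4 * m ^ 4 * y s) ->
  let F := concomitant
    (affine_diff 0 a b c d (beam0 m)) (affine_diff 1 a b c d (beam1 m))
    (affine_diff 2 a b c d (beam2 m)) (affine_diff 3 a b c d (beam3 m))
    y y1 y2 y3 in
  F lo <= F hi.
Proof.
intros Ha Hb H0 Hlh H1 Hbeam Harg HC Hq F.
apply concomitant_increasing with (M := 4 * m ^ 4) (y4 := y4); auto.
- intros s. apply is_derive_affine_diff, is_derive_beam0.
- intros s. apply is_derive_affine_diff, is_derive_beam1.
- intros s. apply is_derive_affine_diff, is_derive_beam2.
- intros s.
  replace (- (4 * m ^ 4) * affine_diff 0 a b c d (beam0 m) s) with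
    (affine_diff 4 a b c d (fun t => -4 * beam0 m t) s).
  + apply is_derive_affine_diff, is_derive_beam3.
  + unfold affine_diff.
    replace (a ^ 4) with (m ^ 4) by (replace (a ^ 4) with ((a ^ 2) ^ 2) by ring;
      rewrite Ha; ring).
    replace (b ^ 4) with (m ^ 4) by (replace (b ^ 4) with ((b ^ 2) ^ 2) by ring;
      rewrite Hb; ring).
    ring.
- intros s Hs. unfold affine_diff.
  pose proof (beam0_increasing m Hbeam _ _ (Harg s Hs)). simpl. lra.
Qed.

(** Up to a positive factor the Green function is J (m (1 - |x - s|)) -
    J (m (1 - x - s)) with J = [beam0 m]: it satisfies the boundary conditions
    because J is even, its derivatives of order at most 2 in s are continuous at
    s = x because J' m = 0, and it is nonnegative because J increases on [0, m] and
    |1 - x - s| <= 1 - |x - s|.  Green's identity is used here as monotonicity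
    of the concomitant on [0, x] and on [x, 1]; it vanishes at 0 and 1, and its
    jump at x is a positive multiple of y x. *)
Lemma navier_maximum_principle_quartic (m : R) (y y1 y2 y3 y4 : R -> R) :
  0 < m ->
  (forall t, 0 <= t <= m -> 0 <= beam1 m t) ->
  C4_derivatives y y1 y2 y3 y4 ->
  (forall s, 0 < s < 1 -> 0 <= y4 s + 4 * m ^ 4 * y s) ->
  y 0 = 0 -> y 1 = 0 -> y2 0 = 0 -> y2 1 = 0 ->
  forall x, I01 x -> 0 <= y x.
Proof.
intros Hm Hbeam HC Hq B1 B2 B3 B4 x [Hx0 Hx1].
assert (Habs : forall v w, v <= 1 -> - v <= w <= v -> Rabs (m * w) <= m * v <= m).
{ intros v w Hv Hw. split.
  - rewrite Rabs_mult, (Rabs_pos_eq m) by lra.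
    apply Rmult_le_compat_l; [lra |]. apply Rabs_le. lra.
  - nra. }
assert (Left := beam_concomitant_increasing m 0 x m (- m) (m * (1 - x)) (m * (1 - x))
  y y1 y2 y3 y4).
assert (Right := beam_concomitant_increasing m x 1 (- m) (- m) (m * (1 + x))
  (m * (1 - x)) y y1 y2 y3 y4).
cbv zeta in Left, Right.
assert (L : concomitant
    (affine_diff 0 m (- m) (m * (1 - x)) (m * (1 - x)) (beam0 m))
    (affine_diff 1 m (- m) (m * (1 - x)) (m * (1 - x)) (beam1 m))
    (affine_diff 2 m (- m) (m * (1 - x)) (m * (1 - x)) (beam2 m))
    (affine_diff 3 m (- m) (m * (1 - x)) (m * (1 - x)) (beam3 m)) y y1 y2 y3 0 = 0).
{ unfold concomitant. rewrite B1, B3. unfold affine_diff.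
  replace (- m * 0 + m * (1 - x)) with (m * 0 + m * (1 - x)) by ring. ring. }
assert (Rt : concomitant
    (affine_diff 0 (- m) (- m) (m * (1 + x)) (m * (1 - x)) (beam0 m))
    (affine_diff 1 (- m) (- m) (m * (1 + x)) (m * (1 - x)) (beam1 m))
    (affine_diff 2 (- m) (- m) (m * (1 + x)) (m * (1 - x)) (beam2 m))
    (affine_diff 3 (- m) (- m) (m * (1 + x)) (m * (1 - x)) (beam3 m)) y y1 y2 y3 1 = 0).
{ unfold concomitant. rewrite B2, B4. unfold affine_diff.
  replace (- m * 1 + m * (1 - x)) with (- (- m * 1 + m * (1 + x))) by ring.
  rewrite beam0_even, beam2_even. ring. }
rewrite L in Left. rewrite Rt in Right. clear L Rt.
assert (Left' := Left ltac:(easy) ltac:(ring) ltac:(lra) Hx0 Hx1 Hbeam).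
assert (Right' := Right ltac:(ring) ltac:(ring) Hx0 Hx1 ltac:(lra) Hbeam).
clear Left Right.
match type of Left' with ?P -> _ => assert (HP : P) end.
{ intros s Hs.
  replace (- m * s + m * (1 - x)) with (m * (1 - x - s)) by ring.
  replace (m * s + m * (1 - x)) with (m * (1 - x + s)) by ring.
  apply Habs; lra. }
specialize (Left' HP HC Hq). clear HP.
match type of Right' with ?P -> _ => assert (HP : P) end.
{ intros s Hs.
  replace (- m * s + m * (1 - x)) with (m * (1 - x - s)) by ring.
  replace (- m * s + m * (1 + x)) with (m * (1 + x - s)) by ring.
  apply Habs; lra. }
specialize (Right' HP HC Hq). clear HP.
unfold concomitant, affine_diff in Left', Right'.
replace (m * x + m * (1 - x)) with m in Left' by ring.
replace (- m * x + m * (1 + x)) with m in Right' by ring.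
rewrite beam1_end in Left', Right'.
pose proof (beam3_end_neg m Hm) as Hneg.
assert (Hjump : 0 <= (- 2 * m ^ 3 * beam3 m m) * y x).
{ simpl in *. lra. }
assert (0 < m ^ 3) by (apply pow_lt; lra).
apply Rmult_le_reg_l with (- 2 * m ^ 3 * beam3 m m); nra.
Qed.

Lemma quartic_root (M : R) : 0 < M -> exists m, 0 < m /\ 4 * m ^ 4 = M.
Proof.
intros HM. exists (sqrt (sqrt (M / 4))). split.
- apply sqrt_lt_R0, sqrt_lt_R0. lra.
- pose proof (sqrt_sqrt (sqrt (M / 4)) (sqrt_pos _)) as E1.
  pose proof (sqrt_sqrt (M / 4) ltac:(lra)) as E2.
  set (r := sqrt (sqrt (M / 4))) in *.
  replace (r ^ 4) with ((r * r) * (r * r)) by ring. rewrite E1, E2. field.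
Qed.

Lemma navier_maximum_principle (M c0 : R) (q y : R -> R) :
  is_c0 c0 -> 0 < M <= c0 ->
  homogeneous_solution M q y -> (forall x, 0 < x < 1 -> 0 <= q x) ->
  forall x, I01 x -> 0 <= y x.
Proof.
intros [k0 [[Hk0 _] [Hmin ->]]] [HM HMc] (y1 & y2 & y3 & y4 & HC & Hode & B1 & B2 & B3 & B4) Hq.
destruct (quartic_root M HM) as [m [Hm <-]].
assert (Hmk : m <= k0).
{ destruct (Rle_lt_dec m k0) as [| Hlt]; [easy |].
  assert (k0 ^ 2 < m ^ 2) by nra.
  assert (k0 ^ 4 < m ^ 4); [| lra].
  replace (m ^ 4) with ((m ^ 2) ^ 2) by ring.
  replace (k0 ^ 4) with ((k0 ^ 2) ^ 2) by ring.
  pose proof (pow2_ge_0 k0). nra. }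
destruct (gap_nonneg_below_first_root k0 m Hmin (conj Hm Hmk)) as [Hm32 Hgap].
apply navier_maximum_principle_quartic with (m := m) (y1 := y1) (y2 := y2)
  (y3 := y3) (y4 := y4); auto.
- intros t Ht. now apply beam1_nonneg.
- intros s Hs. rewrite Hode by easy. auto.
Qed.

(** * Contractions of the space of continuous functions *)

Definition bounded01 (c : R) (f : R -> R) : Prop :=
  forall x, I01 x -> Rabs (f x) <= c.

Lemma continuous01_uniform_limit (w : nat -> R -> R) (u : R -> R) (B : nat -> R) :
  (forall n, continuous01 (w n)) ->
  (forall n, bounded01 (B n) (fun x => u x - w n x)) ->
  is_lim_seq B 0 -> continuous01 u.
Proof.
intros Hw Hu HB. apply continuous01_eps. intros x Hx eps.
assert (He : 0 < eps / 3) by (pose proof (cond_pos eps); lra).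
destruct (proj2 (is_lim_seq_spec _ _) HB (mkposreal _ He)) as [n Hn].
specialize (Hn n (Nat.le_refl n)). simpl in Hn.
destruct (proj1 (continuous01_eps _) (Hw n) x Hx (mkposreal _ He)) as [d Hd].
exists d. intros y Hy Hyx. specialize (Hd y Hy Hyx). simpl in Hd.
pose proof (Hu n x Hx) as Ux. pose proof (Hu n y Hy) as Uy. cbv beta in Ux, Uy.
apply Rabs_def2 in Hn. apply Rabs_def2 in Hd.
apply Rabs_le_between in Ux. apply Rabs_le_between in Uy.
apply Rabs_def1; lra.
Qed.

Section Banach.

Variables (Phi : (R -> R) -> R -> R) (theta : R).
Hypothesis Htheta : 0 <= theta < 1.
Hypothesis Phi_continuous : forall u, continuous01 u -> continuous01 (Phi u).
Hypothesis Phi_contraction : forall u v c,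
  continuous01 u -> continuous01 v -> bounded01 c (fun x => u x - v x) ->
  bounded01 (theta * c) (fun x => Phi u x - Phi v x).

Fixpoint picard (n : nat) : R -> R :=
  match n with O => fun _ => 0 | S n => Phi (picard n) end.

Lemma picard_continuous (n : nat) : continuous01 (picard n).
Proof.
induction n as [| n IH]; [apply continuous01_const | now apply Phi_continuous].
Qed.

Lemma picard_step (C : R) :
  bounded01 C (picard 1) ->
  forall n, bounded01 (C * theta ^ n) (fun x => picard (S n) x - picard n x).
Proof.
intros HC. induction n as [| n IH].
- intros x Hx. rewrite pow_O, Rmult_1_r. simpl picard at 2.
  rewrite Rminus_0_r. now apply HC.
- replace (C * theta ^ S n) with (theta * (C * theta ^ n)) by (simpl; ring).
  apply Phi_contraction; auto using picard_continuous.
Qed.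

(** Summing the geometric series of the steps; the bound does not depend on p,
    so it passes to the limit. *)
Lemma picard_cauchy (C : R) :
  0 <= C -> bounded01 C (picard 1) ->
  forall n p, bounded01 (C / (1 - theta) * theta ^ n)
    (fun x => picard (n + p) x - picard n x).
Proof.
intros HC0 HC n p x Hx.
assert (Ht : 0 < 1 - theta) by lra.
(* The exact geometric sum, which unlike the final bound is inductive in p. *)
apply Rle_trans with (C / (1 - theta) * theta ^ n * (1 - theta ^ p)).
- induction p as [| p IH].
  + rewrite Nat.add_0_r, Rminus_diag, Rabs_R0. simpl. lra.
  + rewrite Nat.add_succ_r.
    replace (picard (S (n + p)) x - picard n x) with
      ((picard (S (n + p)) x - picard (n + p) x) + (picard (n + p) x - picard n x))
      by ring.
    eapply Rle_trans; [apply Rabs_triang |].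
    pose proof (picard_step C HC (n + p) x Hx) as Hs. cbv beta in Hs.
    rewrite pow_add in Hs.
    replace (C / (1 - theta) * theta ^ n * (1 - theta ^ S p)) with
      (C * (theta ^ n * theta ^ p) + C / (1 - theta) * theta ^ n * (1 - theta ^ p))
      by (simpl; field; lra).
    lra.
- assert (0 <= C / (1 - theta)) by (apply Rdiv_le_0_compat; lra).
  assert (0 <= theta ^ n) by (apply pow_le; lra).
  assert (0 <= theta ^ p) by (apply pow_le; lra).
  assert (0 <= C / (1 - theta) * theta ^ n) by (apply Rmult_le_pos; lra).
  nra.
Qed.

(** Banach's fixed point theorem in C[0,1]: the pointwise limit of the Picard
    iterates is a uniform limit by the geometric Cauchy estimate, hence is
    continuous, and the contraction estimate lets Phi pass to the limit. *)
Lemma contraction_fixed_point : exists u, continuous01 u /\ equal01 (Phi u) u.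
Proof.
destruct (abs_max01 (picard 1) (picard_continuous 1)) as [x0 [_ HC]].
set (C := Rabs (picard 1 x0)) in HC.
assert (HC0 : 0 <= C) by apply Rabs_pos.
set (B := fun n => C / (1 - theta) * theta ^ n).
assert (HB : is_lim_seq B 0).
{ replace (Finite 0) with (Rbar_mult (C / (1 - theta)) 0)
    by (simpl; f_equal; ring).
  apply is_lim_seq_scal_l, is_lim_seq_geom. rewrite Rabs_pos_eq; lra. }
set (u := fun x => real (Lim_seq (fun n => picard n x))).
assert (Hcv : forall x, I01 x -> is_lim_seq (fun n => picard n x) (u x)).
{ intros x Hx. apply Lim_seq_correct', ex_lim_seq_cauchy_corr. intros eps.
  assert (He : 0 < eps / 2) by (pose proof (cond_pos eps); lra).
  destruct (proj2 (is_lim_seq_spec _ _) HB (mkposreal _ He)) as [N HN].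
  specialize (HN N (Nat.le_refl N)). simpl in HN. apply Rabs_def2 in HN.
  exists N. intros n m Hn Hm.
  pose proof (picard_cauchy C HC0 HC N (n - N) x Hx) as Pn.
  pose proof (picard_cauchy C HC0 HC N (m - N) x Hx) as Pm. cbv beta in Pn, Pm.
  replace (N + (n - N))%nat with n in Pn by lia.
  replace (N + (m - N))%nat with m in Pm by lia.
  fold (B N) in Pn, Pm.
  apply Rabs_le_between in Pn. apply Rabs_le_between in Pm.
  apply Rabs_def1; lra. }
assert (Hu : forall n, bounded01 (B n) (fun x => u x - picard n x)).
{ intros n x Hx.
  apply (is_lim_seq_le (fun p => Rabs (picard (n + p) x - picard n x)) (fun _ => B n)
    (Rabs (u x - picard n x)) (B n)).
  - intros p. now apply picard_cauchy.
  - apply (is_lim_seq_abs _ (Finite (u x - picard n x))).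
    apply is_lim_seq_minus'; [| apply is_lim_seq_const].
    apply is_lim_seq_ext with (fun p => picard (p + n) x).
    + intros p. now rewrite Nat.add_comm.
    + apply (is_lim_seq_incr_n (fun p => picard p x)). now apply Hcv.
  - apply is_lim_seq_const. }
assert (Huc : continuous01 u).
{ apply continuous01_uniform_limit with picard B; auto using picard_continuous. }
exists u. split; [easy |].
intros x Hx.
assert (Hle : forall n, Rabs (Phi u x - u x) <= 2 * B n).
{ intros n.
  pose proof (Phi_contraction u (picard n) (B n) Huc (picard_continuous n) (Hu n) x Hx) as P1.
  pose proof (Hu (S n) x Hx) as P2. cbv beta in P1, P2. simpl picard in P2.
  replace (B (S n)) with (theta * B n) in P2 by (unfold B; simpl; ring).
  assert (0 <= B n).
  { unfold B. apply Rmult_le_pos; [apply Rdiv_le_0_compat; lra | apply pow_le; lra]. }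
  apply Rabs_le_between in P1. apply Rabs_le_between in P2.
  apply Rabs_le_between. nra. }
assert (L : Rbar_le (Rabs (Phi u x - u x)) (Rbar_mult 2 0)).
{ apply (is_lim_seq_le (fun _ => Rabs (Phi u x - u x)) (fun n => 2 * B n)); [easy | |].
  - apply is_lim_seq_const.
  - now apply is_lim_seq_scal_l. }
simpl in L. pose proof (Rabs_pos (Phi u x - u x)).
assert (Z : Rabs (Phi u x - u x) = 0) by lra.
apply Rabs_eq_0 in Z. lra.
Qed.

End Banach.

(** * The integral operator *)

Lemma continuous_square01_uniform (k : R -> R -> R) :
  continuous_square01 k ->
  forall eps : posreal, exists delta : posreal,
    forall x x' t t', I01 x -> I01 x' -> I01 t -> I01 t' ->
      Rabs (x' - x) < delta -> Rabs (t' - t) < delta ->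
      Rabs (k x' t' - k x t) < eps.
Proof.
intros Hk eps.
destruct (uniform_continuity_2d (fun x t => k (clamp x) (clamp t)) 0 1 0 1) with eps
  as [d Hd].
- intros x t _ _ e.
  assert (Hsq : square01 (clamp x, clamp t)) by (split; apply clamp_I01).
  destruct (proj1 (filterlim_locally _ _) (Hk _ Hsq) e) as [d Hd].
  exists d. intros x' t' Hx Ht.
  apply (Hd (clamp x', clamp t')).
  + split; (eapply Rle_lt_trans; [apply clamp_lipschitz | eassumption]).
  + split; apply clamp_I01.
- exists d. intros x x' t t' Hx Hx' Ht Ht' H1 H2.
  specialize (Hd x t x' t' Hx Ht Hx' Ht' H1 H2).
  now rewrite !clamp_id in Hd by easy.
Qed.

Lemma continuous_square01_section (k : R -> R -> R) (x : R) :
  continuous_square01 k -> I01 x -> continuous01 (k x).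
Proof.
intros Hk Hx. apply continuous01_eps. intros t Ht eps.
destruct (continuous_square01_uniform k Hk eps) as [d Hd].
exists d. intros t' Ht' H. apply Hd; try easy.
rewrite Rminus_diag, Rabs_R0. apply cond_pos.
Qed.

Lemma RInt_bounded01 (f : R -> R) (c : R) :
  continuous01 f -> bounded01 c f -> Rabs (RInt f 0 1) <= c.
Proof.
intros Hf Hb. replace c with ((1 - 0) * c) by ring.
apply abs_RInt_le_const; [lra | now apply ex_RInt_continuous01 | exact Hb].
Qed.

Lemma RInt01_minus (f g : R -> R) :
  continuous01 f -> continuous01 g ->
  RInt (fun t => f t - g t) 0 1 = RInt f 0 1 - RInt g 0 1.
Proof.
intros Hf Hg. exact (RInt_minus (V := R_CompleteNormedModule) f g 0 1
  (ex_RInt_continuous01 f Hf) (ex_RInt_continuous01 g Hg)).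
Qed.

(** By uniform continuity of k on the square, k x' and k x are uniformly close
    in the second variable when x' is close to x. *)
Lemma integral_operator_continuous (k : R -> R -> R) (u : R -> R) :
  continuous_square01 k -> continuous01 u ->
  continuous01 (fun x => RInt (fun t => k x t * u t) 0 1).
Proof.
intros Hk Hu. apply continuous01_eps. intros x Hx eps.
destruct (abs_max01 u Hu) as [x0 [_ Hb]].
set (c := Rabs (u x0)) in Hb.
assert (Hc : 0 <= c) by apply Rabs_pos.
assert (He : 0 < eps / (c + 1)) by (apply Rdiv_lt_0_compat; [apply cond_pos | lra]).
destruct (continuous_square01_uniform k Hk (mkposreal _ He)) as [d Hd].
exists d. intros x' Hx' H.
assert (Hint : forall z, I01 z -> continuous01 (fun t => k z t * u t)).
{ intros z Hz. apply continuous01_mult; [now apply continuous_square01_section | easy]. }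
rewrite <- RInt01_minus by auto.
apply Rle_lt_trans with (eps / (c + 1) * c).
- apply RInt_bounded01.
  + apply continuous01_ext with (fun t => 1 * (k x' t * u t) + -1 * (k x t * u t)).
    * intros t _. ring.
    * apply continuous01_lin; auto.
  + intros t Ht. replace (k x' t * u t - k x t * u t) with ((k x' t - k x t) * u t) by ring.
    rewrite Rabs_mult. apply Rmult_le_compat; try apply Rabs_pos; [| now apply Hb].
    left. apply (Hd x x' t t); try easy.
    rewrite Rminus_diag, Rabs_R0. apply cond_pos.
- apply Rmult_lt_reg_r with (c + 1); [lra |].
  replace (eps / (c + 1) * c * (c + 1)) with (eps * c) by (field; lra).
  pose proof (cond_pos eps). nra.
Qed.

Lemma integral_operator_contraction (k : R -> R -> R) (normk c : R) (u v : R -> R) (x : R) :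
  continuous_square01 k -> (forall x t, I01 x -> I01 t -> Rabs (k x t) <= normk) ->
  continuous01 u -> continuous01 v -> bounded01 c (fun t => u t - v t) -> I01 x ->
  Rabs (RInt (fun t => k x t * u t) 0 1 - RInt (fun t => k x t * v t) 0 1) <= normk * c.
Proof.
intros Hk Hn Hu Hv Hc Hx.
assert (Hint : forall w, continuous01 w -> continuous01 (fun t => k x t * w t)).
{ intros w Hw. apply continuous01_mult; [now apply continuous_square01_section | easy]. }
rewrite <- RInt01_minus by auto.
apply RInt_bounded01.
- apply continuous01_ext with (fun t => 1 * (k x t * u t) + -1 * (k x t * v t)).
  + intros t _. ring.
  + apply continuous01_lin; auto.
- intros t Ht. replace (k x t * u t - k x t * v t) with (k x t * (u t - v t)) by ring.
  rewrite Rabs_mult.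
  apply Rmult_le_compat; try apply Rabs_pos; [now apply Hn | now apply Hc].
Qed.

(** * The nonlocal problem *)

Lemma homogeneous_solution_lin (M a b : R) (q r y z : R -> R) :
  homogeneous_solution M q y -> homogeneous_solution M r z ->
  homogeneous_solution M (fun x => a * q x + b * r x) (fun x => a * y x + b * z x).
Proof.
intros (y1 & y2 & y3 & y4 & HC & Hode & B1 & B2 & B3 & B4)
  (z1 & z2 & z3 & z4 & HC' & Hode' & B1' & B2' & B3' & B4').
do 4 eexists. split; [exact (C4_derivatives_lin a b _ _ _ _ _ _ _ _ _ _ HC HC') |].
split.
- intros x Hx. rewrite <- Hode, <- Hode' by easy. ring.
- cbv beta. rewrite B1, B2, B3, B4, B1', B2', B3', B4'. repeat split; ring.
Qed.

Lemma homogeneous_solution_ext (M : R) (q r y z : R -> R) :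
  (forall x, 0 < x < 1 -> q x = r x) -> (forall x, y x = z x) ->
  homogeneous_solution M q y -> homogeneous_solution M r z.
Proof.
intros Eq Ey (y1 & y2 & y3 & y4 & (D & HC) & Hode & B1 & B2 & B).
exists y1, y2, y3, y4. split; [| split; [| now rewrite <- !Ey]].
- split; [| exact HC].
  intros x Hx. unfold D_in. rewrite <- Ey.
  intros eps Heps. destruct (D x Hx eps Heps) as [d [Hd1 Hd2]].
  exists d. split; [easy |]. intros w Hw. rewrite <- Ey. now apply Hd2.
- intros x Hx. rewrite <- Ey, <- Eq by easy. now apply Hode.
Qed.

(** Comparison of y with c e, where e solves the problem with right-hand side
    1: both c e - y and c e + y have nonnegative right-hand sides. *)
Lemma comparison_bound (M c0 c : R) (q y e : R -> R) :
  is_c0 c0 -> 0 < M <= c0 ->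
  homogeneous_solution M q y -> homogeneous_solution M (fun _ => 1) e ->
  (forall x, 0 < x < 1 -> Rabs (q x) <= c) ->
  forall x, I01 x -> Rabs (y x) <= c * e x.
Proof.
intros Hc0 HM Hy He Hq x Hx. apply Rabs_le.
assert (Hp : forall s, -1 <= s <= 1 -> 0 <= c * e x + s * y x).
{ intros s Hs.
  refine (navier_maximum_principle M c0 _ _ Hc0 HM
    (homogeneous_solution_lin M c s _ _ _ _ He Hy) _ x Hx).
  intros t Ht. specialize (Hq t Ht). cbv beta. apply Rabs_le_between in Hq. nra. }
pose proof (Hp 1 ltac:(lra)). pose proof (Hp (-1) ltac:(lra)). lra.
Qed.

Definition boundary_cubic (A B C D x : R) : R :=
  A + (B - A - C / 2 - (D - C) / 6) * x + C / 2 * x ^ 2 + (D - C) / 6 * x ^ 3.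

Lemma boundary_cubic_C4 (A B C D : R) :
  C4_derivatives (boundary_cubic A B C D)
    (fun x => (B - A - C / 2 - (D - C) / 6) + C * x + (D - C) / 2 * x ^ 2)
    (fun x => C + (D - C) * x) (fun _ => D - C) (fun _ => 0).
Proof.
repeat split; try apply continuous01_const; apply derivative01_of_is_derive;
  intros x; unfold boundary_cubic; auto_derive; try easy; field.
Qed.

Lemma nonlocal_solution_difference (M N A B C D : R) (k : R -> R -> R) (p y z : R -> R) :
  nonlocal_solution M N k p A B C D y -> nonlocal_solution M N k p A B C D z ->
  homogeneous_solution M
    (fun x => N * (RInt (fun t => k x t * z t) 0 1 - RInt (fun t => k x t * y t) 0 1))
    (fun x => z x - y x).
Proof.
intros (y1 & y2 & y3 & y4 & HC & Hode & B1 & B2 & B3 & B4)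
  (z1 & z2 & z3 & z4 & HC' & Hode' & B1' & B2' & B3' & B4').
apply homogeneous_solution_ext with
  (q := fun x => N * (RInt (fun t => k x t * z t) 0 1 - RInt (fun t => k x t * y t) 0 1))
  (y := fun x => 1 * z x + -1 * y x); [easy | intros; ring |].
do 4 eexists. split; [exact (C4_derivatives_lin 1 (-1) _ _ _ _ _ _ _ _ _ _ HC' HC) |].
split.
- intros x Hx. pose proof (Hode x Hx). pose proof (Hode' x Hx). lra.
- cbv beta. rewrite B1, B2, B3, B4, B1', B2', B3', B4'. repeat split; ring.
Qed.

Lemma nonlocal_solution_continuous (M N A B C D : R) (k : R -> R -> R) (p y : R -> R) :
  nonlocal_solution M N k p A B C D y -> continuous01 y.
Proof.
intros (y1 & y2 & y3 & y4 & (H & _) & _). eapply derivative01_continuous01, H.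
Qed.

(** A fixed point u is only known to agree on [0,1] with the cubic plus the
    solution w of the linear problem; it is the latter sum that has four
    derivatives, and the integral term sees only its values on [0,1]. *)
Lemma nonlocal_solution_of_shift (M N A B C D : R) (k : R -> R -> R) (p u w : R -> R) :
  homogeneous_solution M
    (fun x => (p x - M * boundary_cubic A B C D x)
              + N * RInt (fun t => k x t * u t) 0 1) w ->
  equal01 (fun x => boundary_cubic A B C D x + w x) u ->
  nonlocal_solution M N k p A B C D (fun x => 1 * boundary_cubic A B C D x + 1 * w x).
Proof.
intros (y1 & y2 & y3 & y4 & HC & Hode & B1 & B2 & B3 & B4) Hfix.
do 4 eexists.
split; [exact (C4_derivatives_lin 1 1 _ _ _ _ _ _ _ _ _ _ (boundary_cubic_C4 A B C D) HC) |].
split.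
- intros x Hx. pose proof (Hode x Hx) as E. cbv beta in E.
  rewrite (RInt_ext (fun t => k x t * (1 * boundary_cubic A B C D t + 1 * w t))
    (fun t => k x t * u t)).
  + lra.
  + rewrite Rmin_left, Rmax_right by lra. intros t Ht.
    rewrite <- (Hfix t); [simpl; ring | split; lra].
- cbv beta. rewrite B1, B2, B3, B4. unfold boundary_cubic.
  repeat split; field.
Qed.

Theorem theorem2p1 :
  forall (k : R -> R -> R) (M N c0 : R) (G : R -> R -> R) (normk maxG : R),
    continuous_square01 k ->
    is_c0 c0 -> 0 < M <= c0 -> N <> 0 ->
    is_green M G ->
    is_max_on square01 (fun z : R * R => Rabs (k (fst z) (snd z))) normk ->
    is_max_on I01 (fun x => RInt (fun s => G x s) 0 1) maxG ->
    normk < 1 / (Rabs N * maxG) ->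
    forall (p : R -> R) (A B C D : R),
      continuous01 p ->
      exists y : R -> R,
        unique_solution01 (nonlocal_solution M N k p A B C D) y.
Proof.
intros k M N c0 G normk maxG Hk Hc0 HM HN [_ HG] [[zk [_ Hzk]] Hnormk] [_ HmaxG] Hsmall
  p A B C D Hp.
assert (Hkb : forall x t, I01 x -> I01 t -> Rabs (k x t) <= normk)
  by (intros x t Hx Ht; now apply (Hnormk (x, t))).
assert (Hnk0 : 0 <= normk) by (rewrite <- Hzk; apply Rabs_pos).
clear zk Hzk Hnormk.
set (e := fun x => RInt (fun s => G x s) 0 1) in HmaxG.
assert (He : homogeneous_solution M (fun _ => 1) e).
{ destruct (HG (fun _ => 1) (continuous01_const 1)) as [H _].
  eapply homogeneous_solution_ext; [easy | | exact H].
  intros x. apply RInt_ext. intros s _. apply Rmult_1_r. }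
assert (HmaxG0 : 0 <= maxG).
{ destruct He as (_ & _ & _ & _ & _ & _ & He0 & _). rewrite <- He0.
  apply HmaxG. split; lra. }
pose proof (Rabs_pos_lt N HN) as HN0.
set (theta := Rabs N * normk * maxG).
assert (Htheta : 0 <= theta < 1).
{ split.
  - unfold theta. repeat (apply Rmult_le_pos; try lra).
  - destruct HmaxG0 as [HmaxG1 | HmaxG1]; [| unfold theta; rewrite <- HmaxG1; lra].
    apply Rmult_lt_compat_r with (r := Rabs N * maxG) in Hsmall.
    + replace (1 / (Rabs N * maxG) * (Rabs N * maxG)) with 1 in Hsmall by (field; lra).
      unfold theta. lra.
    + now apply Rmult_lt_0_compat. }
assert (Hcontr : forall u v w c,
  continuous01 u -> continuous01 v -> bounded01 c (fun x => u x - v x) ->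
  homogeneous_solution M (fun x => N * (RInt (fun t => k x t * u t) 0 1
    - RInt (fun t => k x t * v t) 0 1)) w ->
  bounded01 (theta * c) w).
{ intros u v w c Hu Hv Hc Hw x Hx.
  assert (Hc' : 0 <= c).
  { eapply Rle_trans; [apply Rabs_pos | apply (Hc x Hx)]. }
  apply Rle_trans with (Rabs N * (normk * c) * e x).
  - refine (comparison_bound M c0 _ _ _ _ Hc0 HM Hw He _ x Hx).
    intros s Hs. rewrite Rabs_mult. apply Rmult_le_compat_l; [lra |].
    apply integral_operator_contraction; auto. split; lra.
  - replace (theta * c) with (Rabs N * (normk * c) * maxG) by (unfold theta; ring).
    apply Rmult_le_compat_l; [| now apply HmaxG].
    repeat (apply Rmult_le_pos; try lra). }
set (P := boundary_cubic A B C D).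
set (rhs := fun u x => (p x - M * P x) + N * RInt (fun t => k x t * u t) 0 1).
set (Phi := fun u x => P x + RInt (fun s => G x s * rhs u s) 0 1).
assert (HP : continuous01 P)
  by (eapply derivative01_continuous01, (boundary_cubic_C4 A B C D)).
assert (Hsol : forall u, continuous01 u ->
  homogeneous_solution M (rhs u) (fun x => RInt (fun s => G x s * rhs u s) 0 1)).
{ intros u Hu. apply HG. unfold rhs.
  apply continuous01_ext with (fun x => 1 * (1 * p x + - M * P x)
    + N * RInt (fun t => k x t * u t) 0 1); [intros x _; simpl; ring |].
  apply continuous01_lin; [now apply continuous01_lin |].
  now apply integral_operator_continuous. }
destruct (contraction_fixed_point Phi theta Htheta) as [u [Hu Hfix]].
{ intros u Hu. apply continuous01_plus; [easy |].
  destruct (Hsol u Hu) as (y1 & y2 & y3 & y4 & (H & _) & _).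
  eapply derivative01_continuous01, H. }
{ intros u v c Hu Hv Hc. apply Hcontr with u v; auto.
  eapply homogeneous_solution_ext;
    [| | exact (homogeneous_solution_lin M 1 (-1) _ _ _ _ (Hsol u Hu) (Hsol v Hv))].
  - intros x _. unfold rhs. ring.
  - intros x. unfold Phi. ring. }
exists (fun x => 1 * P x + 1 * RInt (fun s => G x s * rhs u s) 0 1).
assert (Hy := nonlocal_solution_of_shift M N A B C D k p u _ (Hsol u Hu) Hfix).
split; [exact Hy |].
intros z Hz x Hx.
fold P in Hy. set (y := fun x => 1 * P x + 1 * RInt (fun s => G x s * rhs u s) 0 1) in *.
change (z x = y x).
pose proof (nonlocal_solution_continuous _ _ _ _ _ _ _ _ _ Hy) as Hyc.
pose proof (nonlocal_solution_continuous _ _ _ _ _ _ _ _ _ Hz) as Hzc.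
pose proof (nonlocal_solution_difference _ _ _ _ _ _ _ _ _ _ Hy Hz) as Hd.
destruct (abs_max01 (fun x => z x - y x)) as [x0 [Hx0 Hmax]].
{ destruct Hd as (d1 & d2 & d3 & d4 & (H & _) & _).
  eapply derivative01_continuous01, H. }
pose proof (Hcontr z y _ _ Hzc Hyc Hmax Hd x0 Hx0) as Hself. cbv beta in Hself, Hmax.
pose proof (Rabs_pos (z x0 - y x0)).
specialize (Hmax x Hx). pose proof (Rabs_pos (z x - y x)).
assert (Z : Rabs (z x - y x) = 0) by nra.
apply Rabs_eq_0 in Z. lra.
Qed.
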